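(* Let $R$ be a Noetherian ring and $I_1,\dots,I_r$ ideals of $R$. Then there exists $\alpha\in\mathbb{N}$ such that $$I_1^{n_1}\cdots I_r^{n_r}:_RJ^{\alpha|\mathbf{n}|}=I_1^{n_1}\cdots I_r^{n_r}:_RJ^{\alpha|\mathbf{n}|+1}$$ for all ideals $J$ of $R$ and all $\mathbf{n}=(n_1,\dots,n_r)\in\mathbb{N}^r$, where $|\mathbf{n}|=n_1+\cdots+n_r$. *)

(* Defs.v *)
From mathcomp Require Import all_boot all_algebra.
Set Implicit Arguments. Unset Strict Implicit. Unset Printing Implicit Defensive.
Import GRing.Theory.
Local Open Scope ring_scope.

Definition subsetR (R : comPzRingType) := R -> Prop.

Definition is_ideal (R : comPzRingType) (I : subsetR R) : Prop :=
  [/\ I 0, (forall x y, I x -> I y -> I (x + y)) &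
      (forall r x, I x -> I (r * x))].

Definition noetherian (R : comPzRingType) : Prop :=
  forall f : nat -> subsetR R,
    (forall k, is_ideal (f k)) ->
    (forall k x, f k x -> f k.+1 x) ->
    exists N, forall m, (N <= m)%N -> forall x, f m x <-> f N x.

Definition unit_ideal (R : comPzRingType) : subsetR R := fun _ => True.

Definition ideal_mul (R : comPzRingType) (I J : subsetR R) : subsetR R :=
  fun x => forall K : subsetR R, is_ideal K ->
    (forall a b, I a -> J b -> K (a * b)) -> K x.

Fixpoint ideal_pow (R : comPzRingType) (I : subsetR R) (n : nat) : subsetR R :=
  match n with
  | 0 => @unit_ideal R
  | k.+1 => ideal_mul (ideal_pow I k) I
  end.

Definition ideal_prod (R : comPzRingType) (s : seq (subsetR R)) : subsetR R :=
  foldr (@ideal_mul R) (@unit_ideal R) s.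

Definition multi_pow (R : comPzRingType) (r : nat) (I : 'I_r -> subsetR R)
  (n : 'I_r -> nat) : subsetR R :=
  ideal_prod [seq ideal_pow (I i) (n i) | i <- enum 'I_r].

Definition colon (R : comPzRingType) (I K : subsetR R) : subsetR R :=
  fun x => forall y, K y -> I (x * y).

Definition abs_n (r : nat) (n : 'I_r -> nat) : nat := (\sum_(i < r) n i)%N.

(* Main.v *)
Require Import Defs.
From HB Require Import structures.
From mathcomp Require Import all_boot all_algebra.
From mathcomp Require Import mpoly.
From Stdlib Require Import Classical ClassicalEpsilon.

(* Let T be the multi-Rees ring, the direct sum of the I^m t^m with m in N^r,
   inside R[t_1, ..., t_r]. It is a quotient of a polynomial ring over R in
   finitely many variables, hence noetherian by Hilbert's basis theorem. In a
   noetherian ring every ideal E has an exponent a such that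
   E : J^k is contained in E : J^a for all J and k (noetherian induction, cutting
   E into primary pieces). Apply this to the ideal of T with components
   I^(m + e_i): there is a single a such that, for all m, J and k, an element y
   of I^m with J^k y in I^(m + e_i) satisfies J^a y in I^(m + e_i). If J^k x lies
   in I^n, climbing from 0 to n one unit vector at a time, with alpha the maximum
   of these exponents over i, shows that J^(alpha |n|) x lies in I^n. *)

Set Implicit Arguments.
Unset Strict Implicit.
Unset Printing Implicit Defensive.

Import GRing.Theory.
Local Open Scope ring_scope.

(** * Ideals, their products and powers, and quotients by one element *)

Section Ideals.
Variable R : comPzRingType.
Implicit Types (I J K L E : subsetR R) (x y z : R).

Lemma ideal0 I : is_ideal I -> I 0. Proof. by case. Qed.

Lemma idealD I x y : is_ideal I -> I x -> I y -> I (x + y).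
Proof. by case=> _ h _; apply: h. Qed.

Lemma idealM I r x : is_ideal I -> I x -> I (r * x).
Proof. by case=> _ _; apply. Qed.

Lemma idealMr I x r : is_ideal I -> I x -> I (x * r).
Proof. by rewrite mulrC; apply: idealM. Qed.

Lemma idealN I x : is_ideal I -> I x -> I (- x).
Proof. by rewrite -mulN1r; apply: idealM. Qed.

Lemma idealB I x y : is_ideal I -> I x -> I y -> I (x - y).
Proof. by move=> hI Ix /(idealN hI); apply: idealD. Qed.

Lemma ideal_sum I (T : Type) (s : seq T) (P : pred T) (F : T -> R) :
  is_ideal I -> (forall t, P t -> I (F t)) -> I (\sum_(t <- s | P t) F t).
Proof.
move=> hI hF; apply: (big_ind I) => //; first exact: ideal0.
by move=> x y; apply: idealD.
Qed.

Lemma unit_is_ideal : is_ideal (@unit_ideal R). Proof. by []. Qed.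

Lemma ideal_mul_is_ideal I J : is_ideal (ideal_mul I J).
Proof.
split=> [K hK _|x y hx hy K hK h|r x hx K hK h]; first exact: ideal0.
  by apply: idealD => //; [apply: hx|apply: hy].
by apply: idealM => //; apply: hx.
Qed.

Lemma ideal_mul_in I J x y : I x -> J y -> ideal_mul I J (x * y).
Proof. by move=> Ix Jy K _; apply. Qed.

Lemma ideal_pow_is_ideal I n : is_ideal (ideal_pow I n).
Proof. by case: n => [|n]; [exact: unit_is_ideal|exact: ideal_mul_is_ideal]. Qed.

Lemma ideal_prod_is_ideal s : is_ideal (@ideal_prod R s).
Proof. by case: s => [|I s]; [exact: unit_is_ideal|exact: ideal_mul_is_ideal]. Qed.

(** Since [ideal_mul] is an intersection of ideals, claims about products are proved by eliminating
    one factor at a time: with the factor [y] fixed, the target ideal for the other one is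
    [colon1 I y]. *)
Definition colon1 I y : subsetR R := fun x => I (x * y).

Lemma colon1_is_ideal I y : is_ideal I -> is_ideal (colon1 I y).
Proof.
move=> hI; rewrite /colon1; split=> [|a b|r a].
- by rewrite mul0r; apply: ideal0.
- by rewrite mulrDl; apply: idealD.
- by rewrite -mulrA; apply: idealM.
Qed.

Lemma colon1_sub I y x : is_ideal I -> I x -> colon1 I y x.
Proof. exact: idealMr. Qed.

Definition adjoin I y : subsetR R := fun x => exists e r, I e /\ x = e + r * y.

Lemma adjoin_is_ideal I y : is_ideal I -> is_ideal (adjoin I y).
Proof.
move=> hI; split.
- by exists 0, 0; rewrite mul0r addr0; split=> //; apply: ideal0.
- move=> _ _ [e [r [Ie ->]]] [e' [r' [Ie' ->]]]; exists (e + e'), (r + r').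
  by rewrite mulrDl addrACA; split=> //; apply: idealD.
- move=> s _ [e [r [Ie ->]]]; exists (s * e), (s * r).
  by rewrite mulrDr mulrA; split=> //; apply: idealM.
Qed.

Lemma adjoin_sub I y x : I x -> adjoin I y x.
Proof. by exists x, 0; rewrite mul0r addr0. Qed.

Lemma adjoin_in I y : is_ideal I -> adjoin I y y.
Proof. by exists 0, 1; rewrite mul1r add0r; split=> //; apply: ideal0. Qed.

Lemma ideal_pow_exp J y n : J y -> ideal_pow J n (y ^+ n).
Proof.
by move=> Jy; elim: n => [|n IHn] //=; rewrite exprSr; apply: ideal_mul_in.
Qed.

(** The inclusion of J^(m+n) in J^m J^n, as an elimination rule. The last factor [j] is absorbed by
    replacing the target [K] with [colon1 K j]. *)
Lemma ideal_powD_elim J m n K : is_ideal K ->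
  (forall u v, ideal_pow J m u -> ideal_pow J n v -> K (u * v)) ->
  forall x, ideal_pow J (m + n) x -> K x.
Proof.
elim: n K => [|n IHn] K hK h x; first by rewrite addn0 => hx; rewrite -[x]mulr1; apply: h.
rewrite addnS /=; apply=> // q j hq Jj.
apply: (IHn (colon1 K j)) hq; first exact: colon1_is_ideal.
by move=> u v hu hv; rewrite /colon1 -mulrA; apply: h => //; apply: ideal_mul_in.
Qed.

Lemma ideal_powD_in J m n u v :
  ideal_pow J m u -> ideal_pow J n v -> ideal_pow J (m + n) (u * v).
Proof.
move=> hu; elim: n v => [|n IHn] v.
  by move=> _; rewrite addn0; apply: idealMr => //; apply: ideal_pow_is_ideal.
rewrite addnS mulrC => hv; apply: (hv (colon1 (ideal_pow J (m + n).+1) u)).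
  exact/colon1_is_ideal/ideal_mul_is_ideal.
move=> q j hq Jj; rewrite /colon1 mulrAC [q * u]mulrC.
by apply: ideal_mul_in => //; apply: IHn.
Qed.

Lemma ideal_pow_anti J m n x : (m <= n)%N -> ideal_pow J n x -> ideal_pow J m x.
Proof.
move/subnKC <-; apply: ideal_powD_elim => [|u v hu _].
  exact: ideal_pow_is_ideal.
by apply: idealMr => //; apply: ideal_pow_is_ideal.
Qed.

Lemma ideal_mul_sub I J I' J' :
  (forall x, I x -> I' x) -> (forall x, J x -> J' x) ->
  forall x, ideal_mul I J x -> ideal_mul I' J' x.
Proof.
move=> hI hJ x; apply=> [|a b /hI Ia /hJ Jb]; first exact: ideal_mul_is_ideal.
exact: ideal_mul_in.
Qed.

Lemma ideal_mulACA_in I J I' J' L L' :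
  (forall x y, I x -> I' y -> L (x * y)) ->
  (forall x y, J x -> J' y -> L' (x * y)) ->
  forall a b, ideal_mul I J a -> ideal_mul I' J' b -> ideal_mul L L' (a * b).
Proof.
move=> hL hL' a b ha hb; have hLL' := ideal_mul_is_ideal L L'.
apply: (ha (colon1 (ideal_mul L L') b)) => [|i j Ii Jj].
  exact: colon1_is_ideal.
rewrite /colon1 mulrC; apply: (hb (colon1 (ideal_mul L L') (i * j))) => [|k l Ik Jl].
  exact: colon1_is_ideal.
by rewrite /colon1 mulrC mulrACA; apply: ideal_mul_in; [apply: hL|apply: hL'].
Qed.

End Ideals.

(** * Consequences of the ascending chain condition *)

Section Noetherian.
Variable R : comPzRingType.
Hypothesis hR : noetherian R.
Implicit Types (I J K L E : subsetR R) (x y z : R).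

(** Were [Q] to fail somewhere, each failing ideal would have a strictly larger failing one, and
    choice would string these into a chain that never stabilizes. *)
Lemma noetherian_ind (Q : subsetR R -> Prop) :
  (forall E, is_ideal E ->
     (forall E' x, is_ideal E' -> (forall y, E y -> E' y) -> E' x -> ~ E x ->
        Q E') -> Q E) ->
  forall E, is_ideal E -> Q E.
Proof.
move=> step E0 hE0; apply: NNPP => nQ0.
pose bad := {E : subsetR R | is_ideal E /\ ~ Q E}.
have next (E : bad) : {E' : bad | (forall y, sval E y -> sval E' y) /\
                                  exists2 x, sval E' x & ~ sval E x}.
  apply: constructive_indefinite_description; case: E => E [hE nQ] /=.
  apply: NNPP => none; apply: nQ; apply: step => // E' x hE' sub E'x nEx.
  apply: NNPP => nQ'; apply: none; exists (exist _ E' (conj hE' nQ')).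
  by split=> //; exists x.
pose f k := iter k (fun E : bad => sval (next E)) (exist _ E0 (conj hE0 nQ0) : bad).
have [k|k x|N stable] := hR (f := fun k => sval (f k)).
- by case: (svalP (f k)).
- by case: (svalP (next (f k))) => + _; apply.
- case: (svalP (next (f N))) => _ [x fx nfx]; apply: nfx.
  by apply/(stable N.+1).
Qed.

Lemma noetherian_fg I : is_ideal I ->
  exists2 s : seq R, (forall x, x \in s -> I x) &
    forall K, is_ideal K -> (forall x, x \in s -> K x) -> forall x, I x -> K x.
Proof.
move=> hI.
have h0 : is_ideal (fun x : R => x = 0).
  by split=> [|x y -> ->|r x ->] //; rewrite ?addr0 ?mulr0.
(* The induction is over ideals [E] inside [I], with the claim that [I] is finitely generated modulo
   [E]; the zero ideal is the case wanted. *)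
suff: (forall x, x = 0 -> I x) ->
  exists2 s : seq R, (forall x, x \in s -> I x) &
    forall K, is_ideal K -> (forall x, x = 0 -> K x) ->
      (forall x, x \in s -> K x) -> forall x, I x -> K x.
  case=> [x ->|s sI sK]; first exact: ideal0.
  by exists s => // K hK; apply: sK => // x ->; apply: ideal0.
move: h0; apply: (noetherian_ind (Q := fun E => (forall x, E x -> I x) ->
  exists2 s : seq R, (forall x, x \in s -> I x) & forall K, is_ideal K -> (forall x, E x -> K x) ->
      (forall x, x \in s -> K x) -> forall x, I x -> K x)) => E hE IH EI.
have [[y Iy nEy]|none] := classic (exists2 y, I y & ~ E y); last first.
  exists [::] => // K hK EK _ x Ix; apply: EK.
  by apply: NNPP => nEx; apply: none; exists x.
have [x||||s sI sK] := IH (adjoin E y) y (adjoin_is_ideal y hE).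
- exact: adjoin_sub.
- exact: adjoin_in.
- exact: nEy.
- move=> _ [e [r [Ee ->]]].
  by apply: idealD => //; [apply: EI|apply: idealM].
exists (y :: s) => [x|K hK EK yK].
  by rewrite inE => /predU1P[->|/sI].
apply: sK => // [_ [e [r [Ee ->]]]|x sx]; last first.
  by apply: yK; rewrite inE sx orbT.
apply: idealD => //; first exact: EK.
by apply: idealM => //; apply: yK; rewrite mem_head.
Qed.

(** If some [y] outside [E] is nilpotent modulo [E], then E + (y) and E : y are strictly larger, and
    their exponents add up, because (E + (y)) (E : y) lies in [E]. Without such a [y], [J] itself
    lies in [E]. *)
Lemma nilpotent_pow_bound E : is_ideal E ->
  exists a, forall J, (forall y, J y -> exists m, E (y ^+ m)) ->
    forall z, ideal_pow J a z -> E z.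
Proof.
move: E; apply: noetherian_ind => E hE IH.
have [[y [m Eym] nEy]|none] :=
    classic (exists2 y, (exists m, E (y ^+ m)) & ~ E y); last first.
  exists 1 => J nilJ z hz; apply: hz => // a b _ Jb; apply: idealM => //.
  by apply: NNPP => nEb; apply: none; exists b => //; apply: nilJ.
(* [w] is the last power of [y] outside [E]. *)
have [w nEw Ewy] : exists2 w, ~ E w & E (w * y).
  elim: m Eym => [|m IHm] Em.
    by case: nEy; rewrite -[y]mulr1; apply: idealM.
  have [Eym|nEym] := classic (E (y ^+ m)); first exact: IHm.
  by exists (y ^+ m); rewrite -?exprSr.
have [|||b hb] := IH (adjoin E y) y (adjoin_is_ideal y hE).
- exact: adjoin_sub.
- exact: adjoin_in.
- exact: nEy.
have [||//|a ha] := IH (colon1 E y) w (colon1_is_ideal y hE).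
- by move=> x; apply: colon1_sub.
- exact: Ewy.
exists (b + a)%N => J nilJ; apply: ideal_powD_elim => // u v.
move=> hu hv; have [|e [r [Ee ->]]] := hb J _ u hu.
  by move=> z /nilJ[k Ezk]; exists k; apply: adjoin_sub.
have : colon1 E y v.
  by apply: ha hv => z /nilJ[k Ezk]; exists k; apply: colon1_sub.
rewrite mulrDl => Evy; apply: idealD => //; first exact: idealMr.
by rewrite -mulrA [y * v]mulrC; apply: idealM.
Qed.

(* If [y] is neither nilpotent nor regular modulo [E], then
   [E = (E + (y^N)) :&: (E : y^N)] for large [N]; otherwise [E] is primary. *)
Lemma uniform_colon E : is_ideal E ->
  exists a, forall J k x, colon E (ideal_pow J k) x -> colon E (ideal_pow J a) x.
Proof.
move: E; apply: noetherian_ind => E hE IH.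
have [[y ynil [w nEw Ewy]]|none] := classic (exists2 y,
    forall m, ~ E (y ^+ m) & exists2 w, ~ E w & E (w * y)); last first.
  (* If [J] has an element [y] not nilpotent modulo [E], then [y] is regular modulo [E], and
     cancelling y^k puts [x] in [E]. Otherwise J^a lies in [E]. *)
  have [a ha] := nilpotent_pow_bound hE; exists a => J k x hx z hz.
  have [[y Jy ynil]|Jnil] := classic (exists2 y, J y & forall m, ~ E (y ^+ m)).
    apply: idealMr => //; have := hx _ (ideal_pow_exp k Jy).
    elim: k {hx} => [|k IHk]; first by rewrite mulr1.
    rewrite exprSr mulrA => Exy; apply: IHk; apply: NNPP => nE.
    by apply: none; exists y => //; exists (x * y ^+ k).
  apply: idealM => //; apply: (ha J) hz => y Jy.
  apply: NNPP => ynil; apply: Jnil; exists y => // m Em.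
  by apply: ynil; exists m.
have [k|k x|N stable] := hR (f := fun k => colon1 E (y ^+ k)).
- exact: colon1_is_ideal.
- by rewrite /colon1 exprSr mulrA; apply: idealMr.
(* The exponent is positive, so [w] lies in E : y^(N+1); as y^(N+1) is not in [E] either, both
   ideals are strictly larger than [E]. *)
have [x||//|a1 h1] := IH _ (y ^+ N.+1) (adjoin_is_ideal (y ^+ N.+1) hE).
- exact: adjoin_sub.
- exact: adjoin_in.
have [x||//|a2 h2] := IH _ w (colon1_is_ideal (y ^+ N.+1) hE).
- exact: colon1_sub.
- by rewrite /colon1 exprS mulrA; apply: idealMr.
exists (maxn a1 a2) => J k x hx z hz.
have [|e [r [Ee def_xz]]] := h1 J k x _ z (ideal_pow_anti (leq_maxl _ _) hz).
  by move=> t /hx; apply: adjoin_sub.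
have := h2 J k x _ z (ideal_pow_anti (leq_maxr _ _) hz).
rewrite def_xz => E2; apply: idealD => //.
(* Multiplying x z = e + r y^(N+1) by y^(N+1) gives r y^(2N+2) in [E]; stability lowers the exponent
   to [N]. *)
have /(stable (N.+1 + N.+1)%N) : colon1 E (y ^+ (N.+1 + N.+1)) r.
  rewrite /colon1 exprD mulrA -[_ * _](addKr (e * y ^+ N.+1)) -mulrDl addrC.
  apply: idealB => //; last exact: idealMr.
  by apply: E2 => t /hx; apply: colon1_sub.
move=> rN; rewrite exprSr mulrA; apply: idealMr => //; apply: rN.
by rewrite leqW ?leq_addr.
Qed.

End Noetherian.

(** * Hilbert's basis theorem *)

Section HilbertBasis.
Variable R : comNzRingType.
Implicit Types (A : subsetR {poly R}) (p q : {poly R}).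

(** Bounding the size, rather than fixing the degree, admits c = 0, so that the leading coefficients
    in degree [d] form an ideal. *)
Definition lead_ideal A (d : nat) : subsetR R :=
  fun c => exists p, [/\ A p, (size p <= d.+1)%N & p`_d = c].

Lemma lead_ideal_is_ideal A d : is_ideal A -> is_ideal (lead_ideal A d).
Proof.
move=> hA; split.
- by exists 0; rewrite size_poly0 coef0; split=> //; apply: ideal0.
- move=> _ _ [p [Ap sp <-]] [q [Aq sq <-]]; exists (p + q).
  rewrite coefD; split=> //; first exact: idealD.
  by apply: leq_trans (size_polyD _ _) _; rewrite geq_max sp.
- move=> r _ [p [Ap sp <-]]; exists (r%:P * p).
  rewrite coefCM; split=> //; first exact: idealM.
  by rewrite mul_polyC; apply: leq_trans (size_scale_leq _ _) sp.
Qed.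

Lemma lead_ideal_mono A B d d' c : is_ideal B -> (forall p, A p -> B p) ->
  (d <= d')%N -> lead_ideal A d c -> lead_ideal B d' c.
Proof.
move=> hB AB /subnK <- [p [/AB Bp sp <-]]; exists ('X^(d' - d) * p).
split; first exact: idealM.
  apply: leq_trans (size_polyMleq _ _) _.
  by rewrite size_polyXn addSn /= -addnS leq_add2l.
by rewrite coefXnM ltnNge leq_addr addKn.
Qed.

(** Subtracting from [p] an element of [A] with the same top coefficient lowers the size. *)
Lemma lead_ideal_inj A B : is_ideal A -> is_ideal B ->
  (forall p, A p -> B p) ->
  (forall d c, lead_ideal B d c -> lead_ideal A d c) ->
  forall p, B p -> A p.
Proof.
move=> hA hB AB BA p; have [n] := ubnP (size p); elim: n p => // n IHn p.
rewrite ltnS leq_eqVlt => /predU1P[sp Bp|]; last exact: IHn.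
case: n sp IHn => [|n] sp IHn.
  have /size_poly_leq0P-> : (size p <= 0)%N by rewrite sp.
  exact: ideal0.
have [|q [Aq sq eq_pq]] := BA n p`_n; first by exists p; rewrite sp.
rewrite -(subrK q p); apply: idealD => //; apply: IHn; last first.
  by apply: idealB => //; apply: AB.
rewrite ltnS; apply/leq_sizeP => j; rewrite leq_eqVlt => /predU1P[<-|nj].
  by rewrite coefB eq_pq subrr.
by rewrite coefB !nth_default ?subrr // (leq_trans _ nj) ?sp.
Qed.

Lemma noetherian_poly : noetherian R -> noetherian {poly R}.
Proof.
move=> hR A hA incA.
have mono k m p : (k <= m)%N -> A k p -> A m p.
  by move/subnKC <-; elim: (m - k)%N => [|n IHn]; rewrite ?addn0 // addnS => /IHn/incA.
have leadP k d := lead_ideal_is_ideal d (hA k).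
have lmono k m d d' c : (k <= m)%N -> (d <= d')%N ->
    lead_ideal (A k) d c -> lead_ideal (A m) d' c.
  by move=> km; apply: lead_ideal_mono (hA m) _ => p; apply: mono.
(* The diagonal chain settles all degrees d >= N at once. Each of the finitely many smaller degrees
   has its own chain, and [M] lies beyond all their stabilization points. *)
have [k|k c|N stableN] := hR (fun k => lead_ideal (A k) k).
- exact: leadP.
- exact: lmono.
have [M [NM stableM]] : exists M, (N <= M)%N /\ forall m d c, (M <= m)%N ->
    (d < N)%N -> lead_ideal (A m) d c -> lead_ideal (A M) d c.
  elim: {2}N => [|n [M [NM IHn]]]; first by exists N.
  have [k|k c|M' stable] := hR (fun k => lead_ideal (A k) n).
  - exact: leadP.
  - exact: lmono.
  exists (maxn M M'); split; first by rewrite leq_max NM.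
  move=> m d c; rewrite geq_max => /andP[Mm M'm].
  rewrite ltnS leq_eqVlt => /predU1P[->|dn].
    by move/(stable m M'm); apply: lmono => //; rewrite leq_maxr.
  by move/(IHn m d c Mm dn); apply: lmono => //; rewrite leq_maxl.
exists M => m Mm p; split; last exact: mono.
apply: lead_ideal_inj p => // [p|d c]; first exact: mono.
have [dN|Nd] := ltnP d N; first exact: stableM.
(* With e = max(m, d), the coefficient goes from (A m, d) up to (A e, e), back along the diagonal to
   (A N, N), and up to (A M, d). *)
move=> /(lmono _ (maxn m d) _ (maxn m d) _ (leq_maxl _ _) (leq_maxr _ _)).
move/(stableN _ (leq_trans Nd (leq_maxr _ _))).
exact: lmono.
Qed.

End HilbertBasis.

(** Each generator [b] adds one polynomial variable, sent to [b], and Hilbert's basis theorem keeps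
    [P] noetherian. The subalgebra stays a predicate [T]; the ring structure is carried by [P]. *)
Lemma noetherian_subalgebra_cover (R B : comNzRingType)
    (psi : {rmorphism R -> B}) (T : B -> Prop) (s : seq B) :
  noetherian R ->
  (forall c, T (psi c)) -> (forall b b', T b -> T b' -> T (b + b')) ->
  (forall b b', T b -> T b' -> T (b * b')) -> (forall b, b \in s -> T b) ->
  exists (P : comNzRingType) (iota : {rmorphism R -> P})
         (phi : {rmorphism P -> B}),
    [/\ noetherian P, forall c, phi (iota c) = psi c, forall p, T (phi p) &
        forall b, b \in s -> exists p, phi p = b].
Proof.
move=> hR Tpsi TD TM; elim: s => [|b s IHs] Ts; first by exists R, idfun, psi.
have [x sx|P [iota [phi [hP phiE Tphi sphi]]]] := IHs.
  by apply: Ts; rewrite inE sx orbT.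
have cb : commr_rmorph phi b by move=> x; apply: mulrC.
exists {poly P}, (polyC \o iota), (horner_morph cb); split.
- exact: noetherian_poly.
- by move=> c /=; rewrite horner_morphC.
- move=> p; elim/poly_ind: p => [|p c IHp]; first by rewrite rmorph0 -(rmorph0 psi).
  rewrite rmorphD rmorphM /= horner_morphX horner_morphC.
  by apply: TD => //; apply: TM => //; apply: Ts; rewrite mem_head.
- move=> x; rewrite inE => /predU1P[->|/sphi[p <-]].
    by exists 'X; rewrite /= horner_morphX.
  by exists p%:P; rewrite /= horner_morphC.
Qed.

(** * Extension of ideal powers along a ring morphism *)

Section ExtendedPowers.
Variables (R P : comPzRingType) (iota : {rmorphism R -> P}) (J : subsetR R).

(** Only a set, but [ideal_mul] generates ideals, so its powers are the extensions of the J^k to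
    [P]. *)
Definition image_set : subsetR P := fun q => exists2 j, J j & q = iota j.

Lemma image_pow_elim k (L : subsetR P) : is_ideal L ->
  (forall z, ideal_pow J k z -> L (iota z)) ->
  forall q, ideal_pow image_set k q -> L q.
Proof.
elim: k L => [|k IHk] L hL h q.
  by move=> _; rewrite -[q]mulr1 -(rmorph1 iota); apply: idealM => //; apply: h.
apply=> // q' _ hq' [j Jj ->].
apply: (IHk (colon1 L (iota j))) hq' => [|z hz]; first exact: colon1_is_ideal.
by rewrite /colon1 -rmorphM; apply: h; apply: ideal_mul_in.
Qed.

Lemma image_pow_in k z : ideal_pow J k z -> ideal_pow image_set k (iota z).
Proof.
elim: k z => [|k IHk] z //= hz.
have hK := ideal_mul_is_ideal (ideal_pow image_set k) image_set.
apply: (hz (fun z => ideal_mul (ideal_pow image_set k) image_set (iota z))).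
  split=> [|x y|r x]; first by rewrite rmorph0; apply: ideal0.
    by rewrite rmorphD; apply: idealD.
  by rewrite rmorphM; apply: idealM.
move=> a b ha Jb; rewrite rmorphM; apply: ideal_mul_in; first exact: IHk.
by exists b.
Qed.

End ExtendedPowers.

(** * Products of powers as a family indexed by multidegrees *)

Section MultiPowers.
Variables (R : comPzRingType) (r : nat) (I : 'I_r -> subsetR R).
Implicit Types m n : 'X_{1..r}.

Lemma multi_pow_is_ideal n : is_ideal (multi_pow I n).
Proof. exact: ideal_prod_is_ideal. Qed.

Lemma multi_pow0 x : multi_pow I (0%MM : 'X_{1..r}) x.
Proof.
rewrite /multi_pow; elim: (enum _) x => //= i s IHs x.
by rewrite -[x]mul1r; apply: ideal_mul_in (IHs x); rewrite mnm0E.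
Qed.

Lemma multi_powD_in m n x y :
  multi_pow I m x -> multi_pow I n y -> multi_pow I (m + n)%MM (x * y).
Proof.
rewrite /multi_pow; elim: (enum _) x y => //= i s IHs x y.
apply: ideal_mulACA_in => [a b|]; last exact: IHs.
by rewrite mnmDE; apply: ideal_powD_in.
Qed.

Lemma multi_pow_anti m n x :
  (m <= n)%MM -> multi_pow I n x -> multi_pow I m x.
Proof.
move/mnm_lepP => mn; rewrite /multi_pow; elim: (enum _) x => //= i s IHs x.
by apply: ideal_mul_sub => // y; apply: ideal_pow_anti.
Qed.

Lemma multi_powU i x : is_ideal (I i) -> I i x -> multi_pow I U_(i)%MM x.
Proof.
move=> hi Ii; rewrite /multi_pow.
have : i \in enum 'I_r by rewrite mem_enum.
elim: (enum _) (enum_uniq 'I_r) => //= j s IHs /andP[js us].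
rewrite inE => /predU1P[ij|si]; rewrite mnm1E; last first.
  have /negPf-> : i != j by apply: contraNneq js => <-.
  by rewrite -[x]mul1r; apply: ideal_mul_in => //; apply: IHs.
rewrite -ij eqxx -[x]mulr1; apply: ideal_mul_in.
  by rewrite -[x]mul1r; apply: ideal_mul_in.
elim: s {IHs us} js => //= k s IHs; rewrite inE negb_or -ij => /andP[ik si].
rewrite -[1]mulr1; apply: ideal_mul_in; last by apply: IHs; rewrite -ij.
by rewrite mnm1E (negPf ik).
Qed.

(** Serves to show that degree-one generators reach every I^n t^n, with [K m] the set of [y] such
    that y t^m is reached. *)
Lemma multi_pow_min (K : 'X_{1..r} -> subsetR R) :
  (forall m, is_ideal (K m)) -> (forall x, K 0%MM x) ->
  (forall m n x y, K m x -> K n y -> K (m + n)%MM (x * y)) ->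
  (forall i x, I i x -> K U_(i)%MM x) ->
  forall n x, multi_pow I n x -> K n x.
Proof.
move=> hK K0 KD KI n.
have Kpow i k x : ideal_pow (I i) k x -> K (U_(i) *+ k)%MM x.
  elim: k x => [|k IHk] x; first by rewrite mulm0n.
  by apply=> // a b /IHk Ka /KI Kb; rewrite mulmSr; apply: KD.
(* Writing [n] as a sum of multiples of unit vectors over [enum] makes it unfold in step with the
   product of powers. *)
rewrite {2}[n]multinomUE_id /multi_pow -big_enum /=.
elim: (enum _) => [|i s IHs] x; first by rewrite big_nil.
rewrite big_cons /=; apply=> // a b /Kpow Ka /IHs Kb; exact: KD.
Qed.

End MultiPowers.

(** * The multi-Rees ring and the uniform exponent *)

Section ReesStep.
Variables (R : comNzRingType) (r : nat) (I : 'I_r -> subsetR R).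
Hypotheses (hR : noetherian R) (hI : forall i, is_ideal (I i)).
Implicit Types (m n : 'X_{1..r}) (J : subsetR R).

Definition in_rees (q : {mpoly R[r]}) : Prop := forall m, multi_pow I m q@_m.

(** This is the extension of [I i] to the Rees ring, whose component in degree [m] is I_i I^m. *)
Definition in_rees_shift (i : 'I_r) (q : {mpoly R[r]}) : Prop :=
  forall m, multi_pow I (m + U_(i))%MM q@_m.

Lemma in_reesD p q : in_rees p -> in_rees q -> in_rees (p + q).
Proof.
by move=> hp hq m; rewrite mcoeffD; apply: idealD => //; apply: multi_pow_is_ideal.
Qed.

Lemma in_reesM p q : in_rees p -> in_rees q -> in_rees (p * q).
Proof.
move=> hp hq m; rewrite mcoeffM; apply: ideal_sum => [|k /eqP mE].
  exact: multi_pow_is_ideal.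
by have := multi_powD_in (hp k.1) (hq k.2); rewrite -mE.
Qed.

Lemma in_reesX c n : multi_pow I n c -> in_rees (c%:MP * 'X_[n]).
Proof.
move=> hc m; rewrite mcoeffCM mcoeffX.
have hm := multi_pow_is_ideal I m.
by case: eqP => [<-|_]; rewrite ?mulr1 ?mulr0 //; apply: ideal0.
Qed.

Lemma in_reesC c : in_rees c%:MP.
Proof.
by rewrite -[_%:MP]mulr1 -mpolyX0; apply: in_reesX; apply: multi_pow0.
Qed.

Lemma in_rees_shiftD i p q :
  in_rees_shift i p -> in_rees_shift i q -> in_rees_shift i (p + q).
Proof.
by move=> hp hq m; rewrite mcoeffD; apply: idealD => //; apply: multi_pow_is_ideal.
Qed.

Lemma in_rees_shiftM i p q :
  in_rees p -> in_rees_shift i q -> in_rees_shift i (p * q).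
Proof.
move=> hp hq m; rewrite mcoeffM; apply: ideal_sum => [|k /eqP mE].
  exact: multi_pow_is_ideal.
by have := multi_powD_in (hp k.1) (hq k.2); rewrite addmA -mE.
Qed.

Lemma rees_cover :
  exists (P : comNzRingType) (iota : {rmorphism R -> P})
         (phi : {rmorphism P -> {mpoly R[r]}}),
    [/\ noetherian P, forall c, phi (iota c) = c%:MP, forall p, in_rees (phi p) &
        forall m y, multi_pow I m y -> exists p, phi p = y%:MP * 'X_[m]].
Proof.
have gen i : {s : seq R | (forall x, x \in s -> I i x) /\
    forall K, is_ideal K -> (forall x, x \in s -> K x) -> forall x, I i x -> K x}.
  apply: constructive_indefinite_description.
  by have [s sI sK] := noetherian_fg hR (hI i); exists s.
(* The Rees ring is generated over [R] by the x t_i, with [x] among finitely many generators of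
   [I i]. *)
pose s := [seq x%:MP * 'X_i : {mpoly R[r]} | i <- enum 'I_r, x <- sval (gen i)].
have [||||P [iota [phi [hP phiE Tphi sphi]]]] :=
    @noetherian_subalgebra_cover R {mpoly R[r]} (@mpolyC r R) in_rees s hR.
- exact: in_reesC.
- exact: in_reesD.
- exact: in_reesM.
- move=> _ /allpairsPdep[i [x [_ sx ->]]]; apply: in_reesX.
  by apply: multi_powU => //; case: (svalP (gen i)) => + _; apply.
exists P, iota, phi; split=> //.
pose K m : subsetR R := fun y => exists p, phi p = y%:MP * 'X_[m].
have hK m : is_ideal (K m).
  split=> [|x y [p pE] [q qE]|c x [p pE]].
  - by exists 0; rewrite rmorph0 mpolyC0 mul0r.
  - by exists (p + q); rewrite rmorphD pE qE mpolyCD mulrDl.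
  - by exists (iota c * p); rewrite rmorphM phiE pE mpolyCM mulrA.
apply: (multi_pow_min (K := K)) => // [x|m n x y [p pE] [q qE]|i].
- by exists (iota x); rewrite mpolyX0 mulr1.
- by exists (p * q); rewrite rmorphM pE qE mpolyXD mpolyCM mulrACA.
- case: (svalP (gen i)) => _; apply=> // x sx; apply: sphi.
  by apply/allpairsPdep; exists i, x; rewrite mem_enum.
Qed.

(* The torsion of the Rees ring modulo its shift by [U_(i)] is bounded at once
   for all degrees [m]. *)
Lemma multi_pow_step i : exists a, forall J m y k, multi_pow I m y ->
  colon (multi_pow I (m + U_(i))%MM) (ideal_pow J k) y ->
  colon (multi_pow I (m + U_(i))%MM) (ideal_pow J a) y.
Proof.
have [P [iota [phi [hP phiE Tphi sphi]]]] := rees_cover.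
pose E : subsetR P := fun p => in_rees_shift i (phi p).
have hE : is_ideal E.
  rewrite /E; split=> [|p q|p q].
  - by move=> m; rewrite rmorph0 mcoeff0; apply: ideal0; apply: multi_pow_is_ideal.
  - by rewrite rmorphD; apply: in_rees_shiftD.
  - by rewrite rmorphM; apply: in_rees_shiftM.
have [a ha] := uniform_colon hP hE; exists a => J m y k /sphi[p pE] hk z hz.
(* The lift [p] of y t^m keeps everything in the single degree [m], so membership in [E] only tests
   the coefficient y w there. *)
have phipE w : phi (p * iota w) = (y * w)%:MP * 'X_[m].
  by rewrite rmorphM pE phiE mulrAC -mpolyCM.
have /(_ m) : E (p * iota z).
  apply: (ha (image_set iota J) k) (image_pow_in iota hz) => q hq.
  rewrite mulrC; apply: (image_pow_elim (L := colon1 E p)) hq.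
    exact: colon1_is_ideal.
  move=> w hw n; rewrite mulrC phipE mcoeffCM mcoeffX.
  have hn := multi_pow_is_ideal I (n + U_(i))%MM.
  by case: eqP => [<-|_]; rewrite ?mulr1 ?mulr0; [apply: hk|apply: ideal0].
by rewrite phipE mcoeffCM mcoeffX eqxx mulr1.
Qed.

Lemma multi_pow_colon_bound : exists alpha, forall J n k x,
  colon (multi_pow I n) (ideal_pow J k) x ->
  colon (multi_pow I n) (ideal_pow J (alpha * mdeg n)) x.
Proof.
have step i := constructive_indefinite_description _ (multi_pow_step i).
exists (\max_i sval (step i)) => J n k x hx.
set alpha := \max_i _.
have climb m : (m <= n)%MM ->
    colon (multi_pow I m) (ideal_pow J (alpha * mdeg m)) x.
  move: {2}(mdeg m) (erefl (mdeg m)) => d; elim: d m => [|d IHd] m dm mn.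
    by move=> z _; move/eqP: dm; rewrite mdeg_eq0 => /eqP->; apply: multi_pow0.
  (* A positive degree has a nonzero coordinate [i], so m = m' + e_i with m' one degree lower. *)
  have [i mi] : exists i, m i != 0%N.
    apply/existsP; apply: contraT; rewrite negb_exists => /forallP m0.
    by move: dm; rewrite mdegE big1 // => i _; apply/eqP; rewrite -[_ == _]negbK.
  have le_im : (U_(i) <= m)%MM by rewrite lep1mP.
  have defm := submK le_im; set m' := (m - U_(i))%MM in defm.
  have dm' : mdeg m' = d.
    by apply/eqP; rewrite -eqSS -dm -defm mdegD mdeg1 addn1.
  have m'n : (m' <= n)%MM by apply: lepm_trans mn; apply: lem_subr.
  have {}IHd := IHd m' dm' m'n.
  rewrite -defm mdegD mdeg1 mulnDr muln1 => z hz; rewrite mulrC.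
  have hm := multi_pow_is_ideal I (m' + U_(i))%MM.
  move: z hz; apply: (ideal_powD_elim (K := colon1 _ x)).
    exact: colon1_is_ideal.
  (* For [u] in J^(alpha |m'|), x u lies in I^m' by induction, and J^k x u lies in I^n, hence in
     I^m. The exponent for [i], at most [alpha], then gives x u v in I^m. *)
  move=> u v hu hv; rewrite /colon1 mulrC mulrA.
  apply: (svalP (step i) J m' (x * u) k); first exact: IHd.
    move=> w hw; rewrite defm -mulrA; apply: multi_pow_anti mn _; apply: hx.
    by apply: idealM => //; apply: ideal_pow_is_ideal.
  by apply: ideal_pow_anti hv; apply: (leq_bigmax i).
exact: climb (lepm_refl n).
Qed.

End ReesStep.

(** The polynomial rings used are over nonzero rings; an equality of structures lets hypotheses over
    [R] be transported unchanged. *)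
Lemma comNzRing_of_nonzero (R : comPzRingType) :
  (1 : R) != 0 -> exists R' : comNzRingType, R' = R :> comPzRingType.
Proof.
move=> R1; pose nzR := GRing.PzSemiRing_isNonZero.Build R R1.
exists (HB.pack (GRing.ComPzRing.sort R) nzR : comNzRingType).
by case: R R1 @nzR => T [].
Qed.

Theorem theorem7p1 (R : comPzRingType) (hR : noetherian R) (r : nat)
  (I : 'I_r -> subsetR R) (hI : forall i, is_ideal (I i)) :
  exists alpha : nat,
    forall J : subsetR R, is_ideal J ->
    forall n : 'I_r -> nat,
    forall x : R,
      colon (multi_pow I n) (ideal_pow J (alpha * abs_n n)) x <->
      colon (multi_pow I n) (ideal_pow J (alpha * abs_n n).+1) x.
Proof.
have [R0|R1] := eqVneq (1 : R) 0.
  have all0 (y : R) : y = 0 by rewrite -[y]mulr1 R0 mulr0.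
  by exists 0%N => J _ n x; split=> _ y _; rewrite [x * y]all0; apply: ideal0;
    apply: ideal_prod_is_ideal.
have [R' defR] := comNzRing_of_nonzero R1.
case: R / defR hR I hI {R1} => hR I hI.
have [alpha bound] := multi_pow_colon_bound hR hI.
(* One inclusion holds because powers of [J] decrease; the other is the bound at k = alpha |n| +
   1. *)
exists alpha => J hJ n x; split=> [hx y hy|].
  by apply: hx; apply: ideal_pow_anti hy.
pose m := [multinom n i | i < r].
have -> : multi_pow I n = multi_pow I m.
  by congr ideal_prod; apply: eq_map => i; rewrite mnmE.
have -> : abs_n n = mdeg m by rewrite mdegE; apply: eq_bigr => i _; rewrite mnmE.
exact: bound.
Qed.
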